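(* The systems in the restricted language without $\vee$, namely $\mathbf{MALC}(\backslash,/,\wedge)$, $\mathbf{MALC}^{*}(\backslash,/,\wedge)$, $\mathbf{AMALC}^{*}(\backslash,/,\wedge)$, $\mathbf{ILL}(\multimap,\wedge)$ and $\mathbf{IAL}(\multimap,\wedge)$, are conservative fragments of $\mathbf{MALC}+\mathcal{D}$, $\mathbf{MALC}^{*}+\mathcal{D}$, $\mathbf{AMALC}^{*}+\mathcal{D}$, $\mathbf{ILL}+\mathcal{D}$ and $\mathbf{IAL}+\mathcal{D}$ respectively. That is, for each of the five pairs, a sequent all of whose formulae are in the restricted language ($\backslash,/,\wedge$ for the first three systems; $\multimap,\wedge$ for the last two) is derivable in the system with $\mathcal{D}$ if and only if it is derivable in the corresponding restricted system.
   Context: **Non-commutative systems.** Formulae are built from variables by the binary connectives $\cdot,\backslash,/,\wedge,\vee$. A sequent is $\Gamma\vdash C$, where $\Gamma$ is a finite sequence of formulae and $C$ is a formula. The calculus $\mathbf{MALC}^{*}$ has axioms $A\vdash A$ and the following rules (premises before $\Rightarrow$, conclusion after): - $(\backslash L)$: $\Pi\vdash A$ and $\Gamma,B,\Delta\vdash C$ $\Rightarrow$ $\Gamma,\Pi,A\backslash B,\Delta\vdash C$; $(\backslash R)$: $A,\Pi\vdash B$ $\Rightarrow$ $\Pi\vdash A\backslash B$; - $(/L)$: $\Pi\vdash A$ and $\Gamma,B,\Delta\vdash C$ $\Rightarrow$ $\Gamma,B/A,\Pi,\Delta\vdash C$; $(/R)$: $\Pi,A\vdash B$ $\Rightarrow$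 $\Pi\vdash B/A$; - $(\cdot L)$: $\Gamma,A,B,\Delta\vdash C$ $\Rightarrow$ $\Gamma,A\cdot B,\Delta\vdash C$; $(\cdot R)$: $\Gamma\vdash A$ and $\Delta\vdash B$ $\Rightarrow$ $\Gamma,\Delta\vdash A\cdot B$; - $(\vee L)$: $\Gamma,A,\Delta\vdash C$ and $\Gamma,B,\Delta\vdash C$ $\Rightarrow$ $\Gamma,A\vee B,\Delta\vdash C$; $(\vee R)$: $\Pi\vdash A$ $\Rightarrow$ $\Pi\vdash A\vee B$, and $\Pi\vdash B$ $\Rightarrow$ $\Pi\vdash A\vee B$; - $(\wedge L)$: $\Gamma,A,\Delta\vdash C$ $\Rightarrow$ $\Gamma,A\wedge B,\Delta\vdash C$, and $\Gamma,B,\Delta\vdash C$ $\Rightarrow$ $\Gamma,A\wedge B,\Delta\vdash C$; $(\wedge R)$: $\Pi\vdash A$ and $\Pi\vdash B$ $\Rightarrow$ $\Pi\vdash A\wedge B$; - (Cut): $\Pi\vdash A$ and $\Gamma,A,\Delta\vdash C$ $\Rightarrow$ $\Gamma,\Pi,\Delta\vdash C$. $\mathbf{MALC}$ is the same calculus with the restriction that $\Pi$ is non-empty in $(\backslash R)$ and $(/R)$ (Lambek's restriction; all antecedents are non-empty). $\mathbf{AMALC}^{*}$ is $\mathbf{MALC}^{*}$ plus weakening $(W)$: $\Gamma,\Delta\vdash C$ $\Rightarrow$ $\Gamma,A,\Delta\vdash C$. **Commutative systems.** Formulae are built from variables by $\multimap,\otimes,\wedge,\vee$; sequents are $\Gamma\vdash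 C$ with $\Gamma$ a finite multiset of formulae. Axioms: $p\vdash p$ ($p$ a variable) for $\mathbf{ILL}$; $\Gamma,p\vdash p$ for $\mathbf{IAL}$. Rules for both: - $\Pi\vdash A$ and $\Gamma,B\vdash C$ $\Rightarrow$ $\Gamma,\Pi,A\multimap B\vdash C$; $\Pi,A\vdash B$ $\Rightarrow$ $\Pi\vdash A\multimap B$; - $\Gamma,A,B\vdash C$ $\Rightarrow$ $\Gamma,A\otimes B\vdash C$; $\Gamma\vdash A$ and $\Delta\vdash B$ $\Rightarrow$ $\Gamma,\Delta\vdash A\otimes B$; - $\Gamma,A\vdash C$ and $\Gamma,B\vdash C$ $\Rightarrow$ $\Gamma,A\vee B\vdash C$; $\Pi\vdash A$ $\Rightarrow$ $\Pi\vdash A\vee B$; $\Pi\vdash B$ $\Rightarrow$ $\Pi\vdash A\vee B$; - $\Gamma,A\vdash C$ $\Rightarrow$ $\Gamma,A\wedge B\vdash C$; $\Gamma,B\vdash C$ $\Rightarrow$ $\Gamma,A\wedge B\vdash C$; $\Pi\vdash A$ and $\Pi\vdash B$ $\Rightarrow$ $\Pi\vdash A\wedge B$. The cut rule ($\Pi\vdash A$ and $\Gamma,A\vdash C$ $\Rightarrow$ $\Gamma,\Pi\vdash C$) is admissible in $\mathbf{ILL}$ and $\mathbf{IAL}$. **Fragments.** A calculus name followed by a list of connectives denotes the fragment of the calculus in the language with only those connectives (only formulae in these connectives, and only the axioms, structural rules, cut, and rules for these connectives). **Distributivity.** For a calculus $\mathbf{S}$, $\mathbf{S}+\mathcal{D}$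 denotes $\mathbf{S}$ (in its full language) with the extra axiom scheme $(A\vee C)\wedge(B\vee C)\vdash(A\wedge B)\vee C$ and with cut kept as an official rule. *)

(* Defs.v *)
From HB Require Import structures.
From mathcomp Require Import all_boot.
From mathcomp Require Import finmap multiset.

Set Implicit Arguments.
Unset Strict Implicit.
Unset Printing Implicit Defensive.

(* Formulae over a set [K] of binary connectives; variables are [Var 0],
   [Var 1], and so on. *)
Inductive formula (K : Type) : Type :=
| Var of nat
| Bin of K & formula K & formula K.

Arguments Var {K} _.

Section FormulaChoice.
Variable K : choiceType.

Fixpoint formula_encode (A : formula K) : GenTree.tree (nat + K) :=
  match A with
  | Var n => GenTree.Leaf (inl n)
  | Bin c A1 A2 =>
    GenTree.Node 0
      [:: GenTree.Leaf (inr c); formula_encode A1; formula_encode A2]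
  end.

Fixpoint formula_decode (t : GenTree.tree (nat + K)) : option (formula K) :=
  match t with
  | GenTree.Leaf (inl n) => Some (Var n)
  | GenTree.Node 0 [:: GenTree.Leaf (inr c); t1; t2] =>
    if formula_decode t1 is Some A1 then
      if formula_decode t2 is Some A2 then Some (Bin c A1 A2) else None
    else None
  | _ => None
  end.

Lemma formula_encodeK : pcancel formula_encode formula_decode.
Proof. by elim=> //= c A1 -> A2 ->. Qed.

HB.instance Definition _ := Choice.copy (formula K) (pcan_type formula_encodeK).
End FormulaChoice.

Fixpoint in_language (K : choiceType) (L : seq K) (A : formula K) : bool :=
  if A is Bin c A1 A2
  then [&& c \in L, in_language L A1 & in_language L A2]
  else true.

(* A sequent is a pair (antecedent, succedent); antecedents are of type [Ctx],
   which is [seq] or [{mset _}] of formulae. *)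
Definition sequent_in_language (K : choiceType) (Ctx : predType (formula K))
    (L : seq K) (s : Ctx * formula K) : Prop :=
  (forall A, A \in s.1 -> in_language L A) /\ in_language L s.2.

(* [rule ps s] says that [s] follows from the list of premises [ps] by one
   instance of an axiom or of a rule. In the fragment given by [L], every
   sequent of the derivation, cut formulae included, lies in the language [L];
   thus only the axioms and rules for connectives in [L] can occur. *)
Inductive derivable (K : choiceType) (Ctx : choiceType)
    (rule : seq (Ctx * formula K) -> Ctx * formula K -> Prop)
    (in_lang : Ctx * formula K -> Prop) : Ctx * formula K -> Prop :=
| Derive ps s :
    rule ps s -> in_lang s ->
    (forall p, p \in ps -> derivable rule in_lang p) ->
    derivable rule in_lang s.

Declare Scope sequent_scope.
Declare Scope nc_scope.
Declare Scope c_scope.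
Local Open Scope sequent_scope.

Notation "G ⊢ C" := (@pair _ (formula _) G C) (at level 90, C at level 89)
  : sequent_scope.

Variant nc_connective := NProd | LDiv | RDiv | NMeet | NJoin.

Definition nc_connective_code (c : nc_connective) : nat :=
  match c with NProd => 0 | LDiv => 1 | RDiv => 2 | NMeet => 3 | NJoin => 4 end.

Definition nc_connective_decode (n : nat) : option nc_connective :=
  nth None [:: Some NProd; Some LDiv; Some RDiv; Some NMeet; Some NJoin] n.

Lemma nc_connective_codeK : pcancel nc_connective_code nc_connective_decode.
Proof. by case. Qed.

HB.instance Definition _ :=
  Choice.copy nc_connective (pcan_type nc_connective_codeK).

Notation nc_formula := (formula nc_connective).
Notation nc_sequent := (seq nc_formula * nc_formula)%type.

Notation "A · B" := (Bin NProd A B) (at level 40, left associativity)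
  : nc_scope.
Notation "A \ B" := (Bin LDiv A B) (at level 40, left associativity)
  : nc_scope.
Notation "B / A" := (Bin RDiv B A) : nc_scope.
Notation "A ∧ B" := (Bin NMeet A B) (at level 80, right associativity)
  : nc_scope.
Notation "A ∨ B" := (Bin NJoin A B) (at level 85, right associativity)
  : nc_scope.

Local Open Scope nc_scope.

(* [MALCs] and [AMALCs] are the starred systems, which allow empty
   antecedents. *)
Variant nc_system := MALC | MALCs | AMALCs.

Variant nc_rule (S : nc_system) : seq nc_sequent -> nc_sequent -> Prop :=
| nc_ax A :
    nc_rule S [::] ([:: A] ⊢ A)
| nc_ldivL G P D A B C :
    nc_rule S [:: P ⊢ A; G ++ [:: B] ++ D ⊢ C] (G ++ P ++ [:: A \ B] ++ D ⊢ C)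
| nc_ldivR P A B :
    (S = MALC -> P <> [::]) ->
    nc_rule S [:: [:: A] ++ P ⊢ B] (P ⊢ A \ B)
| nc_rdivL G P D A B C :
    nc_rule S [:: P ⊢ A; G ++ [:: B] ++ D ⊢ C] (G ++ [:: B / A] ++ P ++ D ⊢ C)
| nc_rdivR P A B :
    (S = MALC -> P <> [::]) ->
    nc_rule S [:: P ++ [:: A] ⊢ B] (P ⊢ B / A)
| nc_prodL G D A B C :
    nc_rule S [:: G ++ [:: A; B] ++ D ⊢ C] (G ++ [:: A · B] ++ D ⊢ C)
| nc_prodR G D A B :
    nc_rule S [:: G ⊢ A; D ⊢ B] (G ++ D ⊢ A · B)
| nc_joinL G D A B C :
    nc_rule S [:: G ++ [:: A] ++ D ⊢ C; G ++ [:: B] ++ D ⊢ C]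
      (G ++ [:: A ∨ B] ++ D ⊢ C)
| nc_joinR1 P A B :
    nc_rule S [:: P ⊢ A] (P ⊢ A ∨ B)
| nc_joinR2 P A B :
    nc_rule S [:: P ⊢ B] (P ⊢ A ∨ B)
| nc_meetL1 G D A B C :
    nc_rule S [:: G ++ [:: A] ++ D ⊢ C] (G ++ [:: A ∧ B] ++ D ⊢ C)
| nc_meetL2 G D A B C :
    nc_rule S [:: G ++ [:: B] ++ D ⊢ C] (G ++ [:: A ∧ B] ++ D ⊢ C)
| nc_meetR P A B :
    nc_rule S [:: P ⊢ A; P ⊢ B] (P ⊢ A ∧ B)
| nc_cut G P D A C :
    nc_rule S [:: P ⊢ A; G ++ [:: A] ++ D ⊢ C] (G ++ P ++ D ⊢ C)
| nc_weak G D A C :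
    S = AMALCs ->
    nc_rule S [:: G ++ D ⊢ C] (G ++ [:: A] ++ D ⊢ C).

Variant nc_rule_dist (S : nc_system) : seq nc_sequent -> nc_sequent -> Prop :=
| nc_base ps s :
    nc_rule S ps s -> nc_rule_dist S ps s
| nc_dist A B C :
    nc_rule_dist S [::] ([:: (A ∨ C) ∧ (B ∨ C)] ⊢ (A ∧ B) ∨ C).

Definition nc_in_language (L : seq nc_connective) (s : nc_sequent) : Prop :=
  sequent_in_language L s.

Definition nc_derivable (S : nc_system) (L : seq nc_connective)
    (s : nc_sequent) : Prop :=
  derivable (nc_rule S) (nc_in_language L) s.

Definition nc_full := [:: NProd; LDiv; RDiv; NMeet; NJoin].

Definition nc_derivable_dist (S : nc_system) (s : nc_sequent) : Prop :=
  derivable (nc_rule_dist S) (nc_in_language nc_full) s.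

Local Close Scope nc_scope.

Variant c_connective := Lolli | Tensor | CMeet | CJoin.

Definition c_connective_code (c : c_connective) : nat :=
  match c with Lolli => 0 | Tensor => 1 | CMeet => 2 | CJoin => 3 end.

Definition c_connective_decode (n : nat) : option c_connective :=
  nth None [:: Some Lolli; Some Tensor; Some CMeet; Some CJoin] n.

Lemma c_connective_codeK : pcancel c_connective_code c_connective_decode.
Proof. by case. Qed.

HB.instance Definition _ :=
  Choice.copy c_connective (pcan_type c_connective_codeK).

Notation c_formula := (formula c_connective).
Notation c_sequent := ({mset c_formula}%mset * c_formula)%type.

Notation "A ⊸ B" := (Bin Lolli A B) (at level 45, right associativity)
  : c_scope.
Notation "A ⊗ B" := (Bin Tensor A B) (at level 40, left associativity)
  : c_scope.
Notation "A ∧ B" := (Bin CMeet A B) (at level 80, right associativity)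
  : c_scope.
Notation "A ∨ B" := (Bin CJoin A B) (at level 85, right associativity)
  : c_scope.

Local Open Scope mset_scope.
Local Open Scope c_scope.

Variant c_system := ILL | IAL.

Variant c_rule (S : c_system) : seq c_sequent -> c_sequent -> Prop :=
| c_ax G n :
    (S = ILL -> G = mset0) ->
    c_rule S [::] (G `+` [mset Var n] ⊢ Var n)
| c_lolliL G P A B C :
    c_rule S [:: P ⊢ A; G `+` [mset B] ⊢ C] (G `+` P `+` [mset A ⊸ B] ⊢ C)
| c_lolliR P A B :
    c_rule S [:: P `+` [mset A] ⊢ B] (P ⊢ A ⊸ B)
| c_tensorL G A B C :
    c_rule S [:: G `+` [mset A] `+` [mset B] ⊢ C] (G `+` [mset A ⊗ B] ⊢ C)
| c_tensorR G D A B :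
    c_rule S [:: G ⊢ A; D ⊢ B] (G `+` D ⊢ A ⊗ B)
| c_joinL G A B C :
    c_rule S [:: G `+` [mset A] ⊢ C; G `+` [mset B] ⊢ C]
      (G `+` [mset A ∨ B] ⊢ C)
| c_joinR1 P A B :
    c_rule S [:: P ⊢ A] (P ⊢ A ∨ B)
| c_joinR2 P A B :
    c_rule S [:: P ⊢ B] (P ⊢ A ∨ B)
| c_meetL1 G A B C :
    c_rule S [:: G `+` [mset A] ⊢ C] (G `+` [mset A ∧ B] ⊢ C)
| c_meetL2 G A B C :
    c_rule S [:: G `+` [mset B] ⊢ C] (G `+` [mset A ∧ B] ⊢ C)
| c_meetR P A B :
    c_rule S [:: P ⊢ A; P ⊢ B] (P ⊢ A ∧ B).

(* Cut, only admissible in [c_rule], becomes an official rule here. *)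
Variant c_rule_dist (S : c_system) : seq c_sequent -> c_sequent -> Prop :=
| c_base ps s :
    c_rule S ps s -> c_rule_dist S ps s
| c_cut G P A C :
    c_rule_dist S [:: P ⊢ A; G `+` [mset A] ⊢ C] (G `+` P ⊢ C)
| c_dist A B C :
    c_rule_dist S [::] ([mset (A ∨ C) ∧ (B ∨ C)] ⊢ (A ∧ B) ∨ C).

Definition c_in_language (L : seq c_connective) (s : c_sequent) : Prop :=
  sequent_in_language L s.

Definition c_derivable (S : c_system) (L : seq c_connective)
    (s : c_sequent) : Prop :=
  derivable (c_rule S) (c_in_language L) s.

Definition c_full := [:: Lolli; Tensor; CMeet; CJoin].

Definition c_derivable_dist (S : c_system) (s : c_sequent) : Prop :=
  derivable (c_rule_dist S) (c_in_language c_full) s.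

(* Main.v *)
Require Import Defs.
From HB Require Import structures.
From mathcomp Require Import all_boot finmap multiset.

(** Formulae are interpreted as sets of contexts (words, resp. multisets) in
    the restricted language, with [∧], [∨] read as intersection and union, and
    the product and the implications as complex product and residuals. Since
    unions and intersections of sets distribute over each other, this
    interpretation validates the distributivity axiom. Interpreting a variable
    [p] by the contexts that derive [p], every formula [A] of the restricted
    language contains the context [A], and only contexts that derive [A];
    evaluating a valid restricted sequent at its own antecedent yields a
    derivation of it. *)

Set Implicit Arguments.
Unset Strict Implicit.
Unset Printing Implicit Defensive.

(** * Complex products over a monoid *)

Section ComplexProduct.
Variables (I : eqType) (W : Type) (e : W).

(** The value of an antecedent. [op] stays abstract so that words under concatenation and multisets
    under sum share the same lemmas. *)
Fixpoint complex_prod (op : W -> W -> W) (val : I -> W -> Prop) (s : seq I)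
    (w : W) : Prop :=
  if s is i :: s' then
    exists u v, [/\ w = op u v, val i u & complex_prod op val s' v]
  else w = e.

Lemma complex_prod1 (op : Monoid.law e) val i w :
  complex_prod op val [:: i] w <-> val i w.
Proof.
split=> [[u [_ [-> iu ->]]]|iw]; first by rewrite Monoid.mulm1.
by exists w, e; rewrite Monoid.mulm1.
Qed.

Lemma complex_prod_cat (op : Monoid.law e) val s t w :
  complex_prod op val (s ++ t) w <->
  exists u v, [/\ w = op u v, complex_prod op val s u
                & complex_prod op val t v].
Proof.
elim: s w => [|i s IH] w /=; split.
- by move=> tw; exists e, w; rewrite Monoid.mul1m.
- by move=> [_ [v [-> -> tv]]]; rewrite Monoid.mul1m.
- move=> [u [_ [-> iu /IH [v1 [v2 [-> sv1 tv2]]]]]].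
  exists (op u v1), v2; split=> //; first by rewrite Monoid.mulmA.
  by exists u, v1.
- move=> [_ [v2 [-> [u [v1 [-> iu sv1]]] tv2]]].
  exists u, (op v1 v2); split=> //; first by rewrite Monoid.mulmA.
  by apply/IH; exists v1, v2.
Qed.

Lemma complex_prod_gen op val (s : seq I) (h : I -> W) :
  {in s, forall i, val i (h i)} ->
  complex_prod op val s (\big[op/e]_(i <- s) h i).
Proof.
elim: s => [|i s IH] hs; first by rewrite big_nil.
rewrite big_cons; exists (h i), (\big[op/e]_(j <- s) h j); split=> //.
  by apply: hs; rewrite mem_head.
by apply: IH => j js; apply: hs; rewrite inE js orbT.
Qed.

(** A multiset antecedent is enumerated in an arbitrary order, on which its value must not depend.
    Permutations are generated by swaps of adjacent blocks, which commutativity of [op] absorbs. *)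
Lemma complex_prod_perm (op : Monoid.com_law e) val s t w :
  perm_eq s t -> complex_prod op val s w -> complex_prod op val t w.
Proof.
move=> st; suff swap s1 s2 s3 : complex_prod op val (s1 ++ s2 ++ s3) w ->
    complex_prod op val (s2 ++ s1 ++ s3) w.
  exact: (@catCA_perm_ind _ (complex_prod op val ^~ w) swap _ _ st).
move=> /complex_prod_cat [u1 [v [-> p1]]].
move=> /complex_prod_cat [u2 [u3 [-> p2 p3]]].
apply/complex_prod_cat; exists u2, (op u1 u3); split=> //.
  exact: Monoid.mulmCA.
by apply/complex_prod_cat; exists u1, u3.
Qed.

End ComplexProduct.

(** * Premise lists, languages and monotonicity of derivability *)

Lemma forall_mem1 (T : eqType) (P : T -> Prop) x :
  (forall p, p \in [:: x] -> P p) <-> P x.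
Proof. by split=> [|Px p]; [apply; rewrite mem_head|rewrite inE => /eqP ->]. Qed.

Lemma forall_mem2 (T : eqType) (P : T -> Prop) x y :
  (forall p, p \in [:: x; y] -> P p) <-> P x /\ P y.
Proof.
split=> [h|[Px Py] p]; first by split; apply: h; rewrite !inE eqxx ?orbT.
by rewrite !inE => /orP [] /eqP ->.
Qed.

Lemma in_language_full (K : choiceType) (L : seq K) (A : formula K) :
  (forall c, c \in L) -> in_language L A.
Proof. by move=> fullL; elim: A => //= c A -> B ->; rewrite fullL. Qed.

(** This gives the easy half of conservativity. *)
Lemma derivable_mono (K Ctx : choiceType)
    (rule rule' : seq (Ctx * formula K) -> Ctx * formula K -> Prop)
    (lang lang' : Ctx * formula K -> Prop) s :
  (forall ps s, rule ps s -> rule' ps s) -> (forall s, lang s -> lang' s) ->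
  derivable rule lang s -> derivable rule' lang' s.
Proof.
move=> sub_rule sub_lang; elim=> ps {}s r l _ IH.
by apply: Derive (sub_rule _ _ r) (sub_lang _ l) IH.
Qed.

(** * The word model for the non-commutative systems *)

Section NonCommutative.
Local Open Scope nc_scope.
Local Open Scope sequent_scope.

Variable S : nc_system.

Local Notation restrL := [:: LDiv; RDiv; NMeet].
Notation provable := (nc_derivable S restrL).
Notation restricted := (in_language restrL).

(** The points of the model. Nonemptiness for [MALC] is the semantic counterpart of Lambek's
    restriction. *)
Definition nc_world (W : seq nc_formula) : Prop :=
  all restricted W /\ (S = MALC -> W <> [::]).

(** The divisions ask for a world explicitly: in [MALC] the quantified clause of [A \ A] would
    otherwise admit the empty word. *)
Fixpoint nc_val (A : nc_formula) (W : seq nc_formula) : Prop :=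
  match A with
  | Var n => nc_world W /\ provable (W ⊢ Var n)
  | B · C => exists U V, [/\ W = U ++ V, nc_val B U & nc_val C V]
  | B \ C => nc_world W /\ forall U, nc_val B U -> nc_val C (U ++ W)
  | B / C => nc_world W /\ forall U, nc_val C U -> nc_val B (W ++ U)
  | B ∧ C => nc_val B W /\ nc_val C W
  | B ∨ C => nc_val B W \/ nc_val C W
  end.

Notation nc_prod := (complex_prod [::] cat nc_val).

Definition nc_valid (s : nc_sequent) : Prop :=
  forall W, nc_prod s.1 W -> nc_val s.2 W.

Lemma nc_world_cat U V : nc_world U -> nc_world V -> nc_world (U ++ V).
Proof.
move=> [rU nU] [rV nV]; split; first by rewrite all_cat rU.
by case: U {rU} nU => // nU /nU.
Qed.

Lemma nc_val_world A W : nc_val A W -> nc_world W.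
Proof.
elim: A W => [n|[] B IHB C IHC] W /=; try by case.
- by move=> [U [V [-> /IHB wU /IHC wV]]]; apply: nc_world_cat.
- by move=> [/IHB].
- by case=> [/IHB|/IHC].
Qed.

(** Every factor contributes a world, so in [MALC] only the empty product has to be excluded. *)
Lemma nc_prod_world G W : (S = MALC -> G <> [::]) -> nc_prod G W -> nc_world W.
Proof.
elim: G W => [|A G IH] W nG /=; first by move=> ->; split.
move=> [U [V [-> /nc_val_world wU GV]]].
case: G IH GV {nG} => [_ ->|B G IH GV]; first by rewrite cats0.
by apply: nc_world_cat => //; apply: IH.
Qed.

Lemma nc_derive ps G C :
  nc_rule S ps (G ⊢ C) -> all restricted G -> restricted C ->
  (forall p, p \in ps -> provable p) -> provable (G ⊢ C).
Proof. by move=> r /allP rG rC ?; apply: (Derive r). Qed.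

(** Needed for soundness of weakening. Variables use the rule itself; the other connectives inherit
    the closure from their components. *)
Lemma nc_val_weak1 A U V B :
  S = AMALCs -> restricted B -> nc_val A (U ++ V) ->
  nc_val A (U ++ [:: B] ++ V).
Proof.
move=> eS rB.
have wI X Y : nc_world (X ++ Y) -> nc_world (X ++ [:: B] ++ Y).
  by move=> [+ _]; split; [rewrite !all_cat /= rB -all_cat|rewrite eS].
elim: A U V => [m|[] C IHC D IHD] U V /=.
- move=> [wW dW]; split; first exact: wI.
  have [rI _] := wI _ _ wW.
  apply: (nc_derive (nc_weak _ _ _ _ eS) rI _ _) => // p.
  by rewrite inE => /eqP ->.
- move=> [U' [V' [eW CU DV]]].
  (* The two splittings of the same word need not agree. Cutting [U' ++ V'] at [size U] shows which
     factor receives [B]. *)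
  have -> : U = take (size U) (U' ++ V') by rewrite -eW take_size_cat.
  have -> : V = drop (size U) (U' ++ V') by rewrite -eW drop_size_cat.
  rewrite take_cat drop_cat; case: ltnP => _.
    exists (take (size U) U' ++ [:: B] ++ drop (size U) U'), V'.
    by rewrite -!catA; split=> //; apply: IHC; rewrite cat_take_drop.
  set n := _ - _; exists U', (take n V' ++ [:: B] ++ drop n V').
  by rewrite -!catA; split=> //; apply: IHD; rewrite cat_take_drop.
- move=> [wW h]; split=> [|X CX]; first exact: wI.
  by rewrite catA; apply: IHD; rewrite -catA; apply: h.
- move=> [wW h]; split=> [|X DX]; first exact: wI.
  by rewrite -!catA; apply: IHC; rewrite catA; apply: h.
- by move=> [? ?]; split; [apply: IHC|apply: IHD].
- by case=> ?; [left; apply: IHC|right; apply: IHD].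
Qed.

Lemma nc_val_weak A U X V :
  S = AMALCs -> all restricted X -> nc_val A (U ++ V) -> nc_val A (U ++ X ++ V).
Proof.
move=> eS + AW; elim: X => //= B X IH /andP [rB rX].
exact: (@nc_val_weak1 A U (X ++ V) B eS rB (IH rX)).
Qed.

Lemma nc_prod_ctx G P D W :
  nc_prod (G ++ P ++ D) W <->
  exists g p d, [/\ W = g ++ p ++ d, nc_prod G g, nc_prod P p & nc_prod D d].
Proof.
split.
  move=> /complex_prod_cat [g [v [-> Gg]]].
  by move=> /complex_prod_cat [p [d [-> Pp Dd]]]; exists g, p, d.
move=> [g [p [d [-> Gg Pp Dd]]]].
apply/complex_prod_cat; exists g, (p ++ d); split=> //.
by apply/complex_prod_cat; exists p, d.
Qed.

Lemma nc_valid_ctx G P D C :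
  nc_valid (G ++ P ++ D ⊢ C) <->
  forall g p d, nc_prod G g -> nc_prod P p -> nc_prod D d ->
    nc_val C (g ++ p ++ d).
Proof.
split=> [v g p d Gg Pp Dd|v W /nc_prod_ctx [g [p [d [-> Gg Pp Dd]]]]].
  by apply: v; apply/nc_prod_ctx; exists g, p, d.
exact: v.
Qed.

(** Soundness: products match the comma and divisions are its residuals. Cut composes inclusions
    between values. *)
Lemma nc_rule_valid ps s :
  nc_rule S ps s -> (forall p, p \in ps -> nc_valid p) -> nc_valid s.
Proof.
case: ps s / => [A|G P D A B C|P A B nP|G P D A B C|P A B nP|G D A B C|G D A B
  |G D A B C|P A B|P A B|G D A B C|G D A B C|P A B|G P D A C|G D A C eS].
- by move=> _ W /complex_prod1.
(* [P] and the division form one middle block, whose value lies in that of [B]. *)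
- move=> /forall_mem2 [vA /nc_valid_ctx vC]; rewrite (catA P).
  apply/nc_valid_ctx => g px d Gg /complex_prod_cat [p [x [-> Pp]]].
  move=> /complex_prod1 [_ ABx] Dd.
  by apply: vC => //; apply/complex_prod1/ABx/vA.
- move=> /forall_mem1 vB W PW; split=> [|U AU].
    exact: (nc_prod_world nP PW).
  by apply: vB; exists U, W.
- move=> /forall_mem2 [vA /nc_valid_ctx vC]; rewrite (catA [:: _]).
  apply/nc_valid_ctx => g xp d Gg /complex_prod_cat [x [p [-> + Pp]]].
  move=> /complex_prod1 [_ BAx] Dd.
  by apply: vC => //; apply/complex_prod1/BAx/vA.
- move=> /forall_mem1 vB W PW; split=> [|U AU].
    exact: (nc_prod_world nP PW).
  by apply: vB; apply/complex_prod_cat; exists W, U; split=> //; apply/complex_prod1.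
- move=> /forall_mem1 /nc_valid_ctx vC; apply/nc_valid_ctx => g x d Gg.
  move=> /complex_prod1 [a [b [-> Aa Bb]]] Dd.
  by apply: vC => //; exists a, b; split=> //; apply/complex_prod1.
- move=> /forall_mem2 [vA vB] W /complex_prod_cat [g [d [-> Gg Dd]]].
  by exists g, d; split=> //; [apply: vA|apply: vB].
- move=> /forall_mem2 [/nc_valid_ctx vA /nc_valid_ctx vB].
  apply/nc_valid_ctx => g x d Gg /complex_prod1 ABx Dd.
  by case: ABx => ?; [apply: vA|apply: vB] => //; apply/complex_prod1.
- by move=> /forall_mem1 vA W PW; left; apply: vA.
- by move=> /forall_mem1 vB W PW; right; apply: vB.
- move=> /forall_mem1 /nc_valid_ctx vA.
  apply/nc_valid_ctx => g x d Gg /complex_prod1 [Ax _] Dd.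
  by apply: vA => //; apply/complex_prod1.
- move=> /forall_mem1 /nc_valid_ctx vB.
  apply/nc_valid_ctx => g x d Gg /complex_prod1 [_ Bx] Dd.
  by apply: vB => //; apply/complex_prod1.
- by move=> /forall_mem2 [vA vB] W PW; split; [apply: vA|apply: vB].
- move=> /forall_mem2 [vA /nc_valid_ctx vC]; apply/nc_valid_ctx.
  by move=> g p d Gg Pp Dd; apply: vC => //; apply/complex_prod1/vA.
- move=> /forall_mem1 v; apply/nc_valid_ctx => g x d Gg.
  (* The weakened formula contributes a whole word [x]; being a world, [x] is restricted and can be
     inserted formula by formula. *)
  move=> /complex_prod1 /nc_val_world [rx _] Dd.
  apply: nc_val_weak => //; apply: v; apply/complex_prod_cat.
  by exists g, d.
Qed.

Lemma nc_dist_valid s : nc_derivable_dist S s -> nc_valid s.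
Proof.
elim=> ps {}s; case: ps s / => [ps s r|A B C] _ _ IH.
  exact: nc_rule_valid r IH.
move=> W /complex_prod1 /= [[AW|CW] [BW|CW']]; by [left|right].
Qed.

Lemma nc_world1 A : restricted A -> nc_world [:: A].
Proof. by split=> //=; rewrite andbT. Qed.

(** On restricted formulae truth at a world is exactly derivability from it. For a division, one
    direction tests the clause at the one-letter word of its argument and applies the right rule;
    the other uses cut, which is a rule of the fragment. *)
Lemma nc_val_provable A W :
  restricted A -> nc_val A W <-> nc_world W /\ provable (W ⊢ A).
Proof.
elim: A W => [n|[] B IHB C IHC] W //= /andP [rB rC].
- have axB : nc_val B [:: B].
    apply/IHB => //; split; first exact: nc_world1.
    by apply: (nc_derive (nc_ax _ _) _ _ _); rewrite /= ?rB.
  split=> [[wW h]|[wW dW]]; split=> //.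
    have /IHC [//|_ dC] := h _ axB; have [rW nW] := wW.
    apply: (nc_derive (nc_ldivR _ _ nW) _ _ _); rewrite //= ?rB //.
    exact/forall_mem1.
  move=> U BU; have /IHB [//|wU dB] := BU.
  have wUW := nc_world_cat wU wW; have [rUW _] := wUW; have [rU _] := wU.
  apply/IHC => //; split=> //.
  have rBC : restricted (B \ C) by rewrite /= rB.
  have dC : provable (U ++ [:: B \ C] ⊢ C).
    apply: (nc_derive (nc_ldivL _ [::] U [::] B C C) _ rC _).
      by rewrite !all_cat /= rU rB rC.
    apply/forall_mem2; split=> //.
    by apply: (nc_derive (nc_ax _ _) _ _ _); rewrite /= ?rC.
  have := nc_cut S U W [::] (B \ C) C; rewrite !cats0 => /nc_derive; apply=> //.
  exact/forall_mem2.
- have axC : nc_val C [:: C].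
    apply/IHC => //; split; first exact: nc_world1.
    by apply: (nc_derive (nc_ax _ _) _ _ _); rewrite /= ?rC.
  split=> [[wW h]|[wW dW]]; split=> //.
    have /IHB [//|_ dB] := h _ axC; have [rW nW] := wW.
    apply: (nc_derive (nc_rdivR _ _ nW) _ _ _); rewrite //= ?rB //.
    exact/forall_mem1.
  move=> U CU; have /IHC [//|wU dC] := CU.
  have wWU := nc_world_cat wW wU; have [rWU _] := wWU; have [rU _] := wU.
  apply/IHB => //; split=> //.
  have rBC : restricted (B / C) by rewrite /= rB.
  have dB : provable ([:: B / C] ++ U ⊢ B).
    have := nc_rdivL S [::] U [::] C B B; rewrite /= !cats0 => /nc_derive.
    apply=> //=; first by rewrite rB rC.
    apply/forall_mem2; split=> //.
    by apply: (nc_derive (nc_ax _ _) _ _ _); rewrite /= ?rB.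
  apply: (nc_derive (nc_cut S [::] W U (B / C) B) rWU rB _).
  exact/forall_mem2.
- have rBC : restricted (B ∧ C) by rewrite /= rB.
  rewrite IHB // IHC //; split=> [[[wW dB] [_ dC]]|[wW dW]].
    split=> //; have [rW _] := wW.
    by apply: (nc_derive (nc_meetR _ _ _ _) rW rBC _); apply/forall_mem2.
  have [rW _] := wW.
  (* Both conjuncts follow by cutting [W ⊢ B ∧ C] against a projection. *)
  have cutW D : restricted D -> provable ([:: B ∧ C] ⊢ D) -> provable (W ⊢ D).
    move=> rD dD; have := nc_cut S [::] W [::] (B ∧ C) D.
    by rewrite !cats0 => /nc_derive; apply=> //; apply/forall_mem2.
  have rBC1 : all restricted [:: B ∧ C] by rewrite /= rB rC.
  split; split=> //; apply: cutW => //.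
    apply: (nc_derive (nc_meetL1 _ [::] [::] B C B) rBC1 rB _).
    by apply/forall_mem1/(nc_derive (nc_ax _ _)); rewrite //= rB.
  apply: (nc_derive (nc_meetL2 _ [::] [::] B C C) rBC1 rC _).
  by apply/forall_mem1/(nc_derive (nc_ax _ _)); rewrite //= rC.
Qed.

Lemma nc_conservative s :
  nc_in_language restrL s -> (nc_derivable_dist S s <-> nc_derivable S restrL s).
Proof.
case: s => G C [/= rG rC]; split; last first.
  apply: derivable_mono => [ps s|s _]; first exact: nc_base.
  by split=> [A _|]; apply: in_language_full; case.
(* [G] lies in its own value: it is the concatenation of its one-letter words, each of which derives
   its letter. *)
move=> /nc_dist_valid v; suff /v /nc_val_provable [//|] : nc_prod G G by [].
elim: G rG {v} => //= A G IH rAG; exists [:: A], G; split=> //.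
  have rA : restricted A by apply: rAG; rewrite mem_head.
  apply/nc_val_provable => //; split; first exact: nc_world1.
  by apply: (nc_derive (nc_ax _ _) _ _ _); rewrite /= ?rA.
by apply: IH => B GB; apply: rAG; rewrite inE GB orbT.
Qed.

End NonCommutative.

(** * Multisets as a commutative monoid *)

Section Multisets.
Local Open Scope mset_scope.
Variable K : choiceType.
Implicit Types A B : {mset K}.

HB.instance Definition _ :=
  Monoid.isComLaw.Build {mset K} mset0 msetD (@msetDA K) (@msetDC K) (@mset0D K).

(** Transfers facts on complex products of concatenated lists to sums of contexts. *)
Lemma perm_enum_msetD A B : perm_eq (A `+` B) (A ++ B).
Proof.
apply/eq_seq_msetP/msetP => a.
by rewrite !mset_seqE count_cat !count_mem_mset msetE2.
Qed.

Lemma enum_mset1 (a : K) : [mset a] = [:: a] :> seq K.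
Proof. by rewrite enum_msetn. Qed.

Lemma big_mset1 A : \big[msetD/mset0]_(a <- A) [mset a] = A.
Proof.
rewrite -[RHS]seq_mset_id; elim: (A : seq K) => [|a s IH].
  by rewrite big_nil; apply/msetP => a; rewrite mset_seqE mset0E.
by rewrite big_cons mset_cons IH.
Qed.

End Multisets.

(** * The multiset model for the commutative systems *)

Section Commutative.
Local Open Scope mset_scope.
Local Open Scope c_scope.
Local Open Scope sequent_scope.

Variable S : c_system.

Local Notation restrL := [:: Lolli; CMeet].
Notation provable := (c_derivable S restrL).
Notation restricted := (in_language restrL).

Definition c_world (W : {mset c_formula}) : Prop := {in W, forall A, restricted A}.

(* In [IAL], a variable holds at the contexts that derive it after any
   weakening, so that admissibility of weakening is not needed. *)
Fixpoint c_val (A : c_formula) (W : {mset c_formula}) : Prop :=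
  match A with
  | Var n =>
    forall X, c_world X -> (S = ILL -> X = mset0) -> provable (X `+` W ⊢ Var n)
  | B ⊗ C => exists U V, [/\ W = U `+` V, c_val B U & c_val C V]
  | B ⊸ C => c_world W /\ forall U, c_val B U -> c_val C (W `+` U)
  | B ∧ C => c_val B W /\ c_val C W
  | B ∨ C => c_val B W \/ c_val C W
  end.

Notation c_prod := (complex_prod mset0 msetD c_val).

Definition c_valid (s : c_sequent) : Prop :=
  forall W, c_prod (s.1 : {mset c_formula}) W -> c_val s.2 W.

Lemma c_worldD U V : c_world (U `+` V) <-> c_world U /\ c_world V.
Proof.
split=> [wUV|[wU wV] A].
  by split=> A AW; apply: wUV; rewrite in_msetD AW ?orbT.
by rewrite in_msetD => /orP [/wU|/wV].
Qed.

Lemma c_world0 : c_world mset0.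
Proof. by move=> A; rewrite in_mset0. Qed.

Lemma c_world1 A : c_world [mset A] <-> restricted A.
Proof.
split=> [|rA B]; first by apply; rewrite in_mset1.
by rewrite in_mset1 => /eqP ->.
Qed.

Lemma c_provable_lang s : provable s -> c_world s.1 /\ restricted s.2.
Proof. by case. Qed.

Lemma c_val_world A W : c_val A W -> c_world W.
Proof.
elim: A W => [n|[] B IHB C IHC] W /=; try by case.
- by move=> /(_ mset0 c_world0 (fun _ => erefl)) /c_provable_lang []; rewrite mset0D.
- by move=> [U [V [-> /IHB wU /IHC wV]]]; apply/c_worldD.
- by move=> [/IHB].
- by case=> [/IHB|/IHC].
Qed.

Lemma c_prod_world (G : seq c_formula) W : c_prod G W -> c_world W.
Proof.
elim: G W => [|A G IH] W /=; first by move=> ->; apply: c_world0.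
by move=> [U [V [-> /c_val_world wU /IH wV]]]; apply/c_worldD.
Qed.

Lemma c_derive ps G C :
  c_rule S ps (G ⊢ C) -> c_world G -> restricted C ->
  (forall p, p \in ps -> provable p) -> provable (G ⊢ C).
Proof. by move=> r wG rC ?; apply: (Derive r). Qed.

Lemma c_prodD (G D : {mset c_formula}) W :
  c_prod (G `+` D) W <->
  exists U V, [/\ W = U `+` V, c_prod G U & c_prod D V].
Proof.
rewrite -complex_prod_cat; split; apply: complex_prod_perm.
  exact: perm_enum_msetD.
by rewrite perm_sym perm_enum_msetD.
Qed.

Lemma c_prod1 A W : c_prod [mset A] W <-> c_val A W.
Proof. by rewrite enum_mset1; apply: complex_prod1. Qed.

Lemma c_validD G D C :
  c_valid (G `+` D ⊢ C) <->
  forall g d, c_prod G g -> c_prod D d -> c_val C (g `+` d).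
Proof.
split=> [v g d Gg Dd|v W /c_prodD [g [d [-> Gg Dd]]]]; last exact: v.
by apply: v; apply/c_prodD; exists g, d.
Qed.

Lemma c_valid1 G A C :
  c_valid (G `+` [mset A] ⊢ C) <->
  forall g a, c_prod G g -> c_val A a -> c_val C (g `+` a).
Proof.
rewrite c_validD; split=> v g a Gg ?; apply: v => //; exact/c_prod1.
Qed.

(** Soundness of the cut-free rules; the axiom is the only case that depends on [S]. *)
Lemma c_rule_valid ps s :
  c_rule S ps s -> (forall p, p \in ps -> c_valid p) -> c_valid s.
Proof.
case: ps s / => [G n G0|G P A B C|P A B|G A B C|G D A B|G A B C|P A B|P A B
  |G A B C|G A B C|P A B].
- move=> _; apply/c_valid1 => g a Gg /= pa X wX X0.
  (* The value [g] of the side context joins the weakening [X]. In [ILL] both are empty, as the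
     variable clause demands. *)
  rewrite msetDA; apply: pa.
    by apply/c_worldD; split=> //; apply: c_prod_world Gg.
  move=> SI; rewrite X0 // mset0D.
  by move: Gg; rewrite G0 // enum_mset0.
- move=> /forall_mem2 [vA /c_valid1 vC].
  apply/c_valid1 => gp x /c_prodD [g [p [-> Gg Pp]]] [_ ABx].
  by rewrite -msetDA (msetDC p); apply: vC => //; apply/ABx/vA.
- move=> /forall_mem1 /c_valid1 vB W PW; split=> [|U AU]; last exact: vB.
  exact: c_prod_world PW.
- move=> /forall_mem1 /c_valid1 vC; apply/c_valid1 => g x Gg.
  move=> [a [b [-> Aa Bb]]]; rewrite msetDA; apply: vC => //.
  by apply/c_prodD; exists g, a; split=> //; apply/c_prod1.
- move=> /forall_mem2 [vA vB] W /c_prodD [g [d [-> Gg Dd]]].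
  by exists g, d; split=> //; [apply: vA|apply: vB].
- move=> /forall_mem2 [/c_valid1 vA /c_valid1 vB].
  by apply/c_valid1 => g x Gg [?|?]; [apply: vA|apply: vB].
- by move=> /forall_mem1 vA W PW; left; apply: vA.
- by move=> /forall_mem1 vB W PW; right; apply: vB.
- by move=> /forall_mem1 /c_valid1 vA; apply/c_valid1 => g x Gg [? _]; apply: vA.
- by move=> /forall_mem1 /c_valid1 vB; apply/c_valid1 => g x Gg [_ ?]; apply: vB.
- by move=> /forall_mem2 [vA vB] W PW; split; [apply: vA|apply: vB].
Qed.

Lemma c_dist_valid s : c_derivable_dist S s -> c_valid s.
Proof.
elim=> ps {}s; case: ps s / => [ps s r|G P A C|A B C] _ _ IH.
- exact: c_rule_valid r IH.
- move: IH => /forall_mem2 [vA /c_valid1 vC]; apply/c_validD => g p Gg Pp.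
  by apply: vC => //; apply: vA.
- move=> W /c_prod1 /= [[AW|CW] [BW|CW']]; by [left|right].
Qed.

(* [W] can replace [A] in any antecedent. This bounds [c_val A] from below
   without an appeal to cut, which is not a rule of the restricted systems. *)
Definition c_entails (W : {mset c_formula}) (A : c_formula) : Prop :=
  c_world W /\
  forall X C, provable (X `+` [mset A] ⊢ C) -> provable (X `+` W ⊢ C).

Lemma c_entails1 A : restricted A -> c_entails [mset A] A.
Proof. by move=> rA; split=> //; apply/c_world1. Qed.

(** The bounds are proved together because [⊸] is contravariant: each bound for [B ⊸ C] uses the
    opposite bound for [B]. *)
Lemma c_val_bounds A : restricted A ->
  (forall W, c_entails W A -> c_val A W) /\
  (forall W, c_val A W -> provable (W ⊢ A)).
Proof.
elim: A => [n|[] B IHB C IHC] //=.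
- move=> _; split=> [W [wW eW] X wX X0|W /(_ mset0 c_world0)].
    (* [X] becomes the side context of the axiom, empty in [ILL] by [X0]. *)
    apply: eW; apply: (c_derive (c_ax n X0)) => //.
    by apply/c_worldD; split=> //; apply/c_world1.
  by rewrite mset0D; apply.
- move=> /andP [rB rC]; have [loB upB] := IHB rB; have [loC upC] := IHC rC.
  have rBC : restricted (B ⊸ C) by rewrite /= rB.
  split=> [W [wW eW]|W [wW h]].
    split=> // U BU; apply: loC; have wU := c_val_world BU.
    split=> [|X D dD]; first exact/c_worldD.
    have [/c_worldD [wX _] rD] := c_provable_lang dD.
    (* Once [W] is replaced by [B ⊸ C], the left rule applies with premises [U ⊢ B] and [dD]. *)
    rewrite (msetDC W) msetDA; apply: eW.
    apply: (c_derive (c_lolliL _ _ _ _ _ _)) => //.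
      by apply/c_worldD; split; [apply/c_worldD|apply/c_world1].
    by apply/forall_mem2; split; [apply: upB|].
  apply: (c_derive (c_lolliR _ _ _ _)) => //.
  (* The implication is tested at the context [[mset B]], which the lower bound places in the value
     of [B]. *)
  by apply/forall_mem1/upC/h/loB/c_entails1.
- move=> /andP [rB rC]; have [loB upB] := IHB rB; have [loC upC] := IHC rC.
  have rBC : restricted (B ∧ C) by rewrite /= rB.
  split=> [W [wW eW]|W [/upB dB /upC dC]].
    split; [apply: loB|apply: loC]; split=> // X D dD; apply: eW;
      have [/c_worldD [wX _] rD] := c_provable_lang dD.
      apply: (c_derive (c_meetL1 _ _ _ _ _)) => //; last exact/forall_mem1.
      by apply/c_worldD; split=> //; apply/c_world1.
    apply: (c_derive (c_meetL2 _ _ _ _ _)) => //; last exact/forall_mem1.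
    by apply/c_worldD; split=> //; apply/c_world1.
  have [wW _] := c_provable_lang dB.
  by apply: (c_derive (c_meetR _ _ _ _)) => //; apply/forall_mem2.
Qed.

Lemma c_conservative s :
  c_in_language restrL s -> (c_derivable_dist S s <-> c_derivable S restrL s).
Proof.
case: s => G C [/= rG rC]; split; last first.
  apply: derivable_mono => [ps s|s _]; first exact: c_base.
  by split=> [A _|]; apply: in_language_full; case.
move=> /c_dist_valid v; have [_ upC] := c_val_bounds rC; apply/upC/v.
(* Only the point is split into singletons, the antecedent stays; each singleton lies in the value
   of its formula. *)
rewrite /= -[X in c_prod _ X]big_mset1; apply: complex_prod_gen => A GA.
by have [loA _] := c_val_bounds (rG A GA); apply/loA/c_entails1/rG.
Qed.

End Commutative.

Theorem theorem6 :
  (forall (S : nc_system) (s : nc_sequent),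
     nc_in_language [:: LDiv; RDiv; NMeet] s ->
     (nc_derivable_dist S s <-> nc_derivable S [:: LDiv; RDiv; NMeet] s)) /\
  (forall (S : c_system) (s : c_sequent),
     c_in_language [:: Lolli; CMeet] s ->
     (c_derivable_dist S s <-> c_derivable S [:: Lolli; CMeet] s)).
Proof. by split; [apply: nc_conservative|apply: c_conservative]. Qed.
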